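(* Let $d\in\mathbb{N}$, $K=\mathbb{N}_0^d$ or $K=\mathbb{Z}^d$, $(\Omega,\mathcal F,P)$ a probability space with a $d$-parameter semigroup (group if $K=\mathbb{Z}^d$) $(\theta_k)_{k\in K}$ of $P$-preserving transformations. Let $M$ be a compact separable metric space with Borel $\sigma$-algebra $\mathcal B$, $\tau:M\to M$ continuous, and $\mu$ a $\tau$-invariant probability measure on $(M,\mathcal B)$ such that $\mu(U)>0$ for every non-empty open $U\subseteq M$. Let $\kappa:M\to K$ be measurable, $\kappa_n=\sum_{i=0}^{n-1}\kappa\circ\tau^i$, $S(t,\omega)=(\tau(t),\theta_{\kappa(t)}\omega)$, $\bar P=\mu\otimes P$, and $\mathcal J$ the $\sigma$-algebra of $S$-invariant sets in $\mathcal B\otimes\mathcal F$. Let $F$ be a $\mathcal B\otimes\mathcal F$-measurable, $\bar P$-integrable function on $M\times\Omega$ with $F(t,\cdot)\in L^1(P)$ for all $t\in M$, such that for every $\omega\in\Omega$ the sequence of functions $$t\mapsto\frac1n\sum_{i=0}^{n-1}F\big(\tau^i(t),\theta_{\kappa_i(t)}\omega\big),\qquad n\in\mathbb{N},$$ is equicontinuous on $M$. Then for $P$-almost all $\omega\in\Omega$, $$\sup_{t\in M}\Big|\frac1n\sum_{i=0}^{n-1}F\big(\tau^i(t),\theta_{\kappa_i(t)}\omega\big)-\bar E[F\mid\mathcal J](t,\omega)\Big|\to0\quad(n\to\infty).$$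
   Context: A semigroup of measure-preserving transformations: each $\theta_k$ measurable and $P$-preserving, $\theta_0=\mathrm{Id}$, $\theta_k\circ\theta_l=\theta_{k+l}$ (and $\theta_{-k}=\theta_k^{-1}$ in the group case). $\bar E[\cdot\mid\mathcal J]$ is conditional expectation w.r.t. $\bar P$. *)

(* Defs.v *)
From HB Require Import structures.
From mathcomp Require Import all_boot all_order all_algebra.
From mathcomp Require Import all_classical all_reals all_analysis.
Set Implicit Arguments. Unset Strict Implicit. Unset Printing Implicit Defensive.
Import Order.TTheory GRing.Theory Num.Theory.
Import numFieldNormedType.Exports.
Local Open Scope classical_set_scope.
Local Open Scope ring_scope.

Notation borel_of M := (g_sigma_algebraType (@open M)).

Definition Kset (grp : bool) (d : nat) : set 'rV[int]_d :=
  if grp then setT else [set k | forall i : 'I_d, (0 <= k ord0 i)%R].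

Definition invariant_sets {dT} {T : measurableType dT} (S : T -> T) : set (set T) :=
  [set A | measurable A /\ S @^-1` A = A].

Definition measurable_wrt {T} {R : realType} (G : set (set T)) (g : T -> R) :=
  forall B : set R, measurable B -> G (g @^-1` B).

Definition is_cond_exp {dT} {T : measurableType dT} {R : realType}
  (mu : {measure set T -> \bar R}) (G : set (set T)) (F g : T -> R) :=
  [/\ measurable_wrt G g,
      mu.-integrable setT (EFin \o g) &
      forall A, G A -> (\int[mu]_(x in A) (g x)%:E = \int[mu]_(x in A) (F x)%:E)%E].

(* Main.v *)
(* The averages are Birkhoff averages of F along the skew product S, which preserves
   m = mu \x P. Let g be a conditional expectation of F given the invariant sets, and
   e > 0. The set B where the Birkhoff sums of F - g - e are unbounded above is strictly
   invariant, so the maximal ergodic lemma gives 0 <= \int_B (F - g - e) = - e m(B) and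
   B is null. Together with the same fact for g - F, this shows that the averages
   converge to g almost everywhere; their pointwise limit is strictly invariant, hence
   itself a version of the conditional expectation. By Fubini, for almost every omega
   the averages converge at mu-almost every t, hence on a dense set because mu charges
   every open set. Equicontinuity extends the convergence to all of M, and compactness
   makes it uniform. *)
Require Import Defs.
From HB Require Import structures.
From mathcomp Require Import all_boot all_order all_algebra.
From mathcomp Require Import all_classical all_reals all_analysis.
From mathcomp Require Import measurable_realfun.
From mathcomp Require Import ring lra.
Set Implicit Arguments. Unset Strict Implicit. Unset Printing Implicit Defensive.
Import Order.TTheory GRing.Theory Num.Theory.
Import numFieldNormedType.Exports.
Local Open Scope classical_set_scope.
Local Open Scope ring_scope.

(** * Existence of conditional expectations *)

Lemma measurable_fun_integrable {d} {T : measurableType d} {R : realType}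
    (m : {measure set T -> \bar R}) (D : set T) (h : T -> R) :
  m.-integrable D (EFin \o h) -> measurable_fun D h.
Proof. by move=> /measurable_int/measurable_EFinP. Qed.

Section radon_nikodym_image.
Context {d1 d2} {T1 : measurableType d1} {T2 : measurableType d2} {R : realType}.
Context (m : {finite_measure set T1 -> \bar R}).
Context (f : T1 -> T2) (mf : measurable_fun setT f).
Context (F : T1 -> R) (iF : m.-integrable setT (EFin \o F)).

(* [pushforward] is a measure or a charge only given the proof [mf], which canonical
   inference cannot supply. *)
Let image_measure := pushforward m f.

Let image_measure0 : image_measure set0 = 0%E. Proof. exact: measure0. Qed.

Let image_measure_ge0 A : (0 <= image_measure A)%E. Proof. exact: measure_ge0. Qed.

Let image_measure_sigma_additive : semi_sigma_additive image_measure.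
Proof. exact: measure_semi_sigma_additive. Qed.

HB.instance Definition _ := isMeasure.Build _ _ _ image_measure
  image_measure0 image_measure_ge0 image_measure_sigma_additive.

Let image_measure_fin : fin_num_fun image_measure.
Proof.
by move=> A mA; apply: fin_num_measure; rewrite -[X in measurable X]setTI; exact: mf.
Qed.

HB.instance Definition _ := Measure_isFinite.Build _ _ _ image_measure image_measure_fin.

Let image_charge := pushforward (induced_charge iF) f.

Let image_charge0 : image_charge set0 = 0%E. Proof. exact: charge0. Qed.

Let image_charge_fin : fin_num_fun image_charge.
Proof. exact: fin_num_measure. Qed.

Let image_charge_sigma_additive : semi_sigma_additive image_charge.
Proof. exact: charge_semi_sigma_additive. Qed.

HB.instance Definition _ := isCharge.Build _ _ _ image_charge
  image_charge0 image_charge_fin image_charge_sigma_additive.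

Lemma Radon_Nikodym_image : exists g : T2 -> R,
  [/\ measurable_fun setT g,
      m.-integrable setT (EFin \o (g \o f)) &
      forall B, measurable B -> (\int[m]_(x in f @^-1` B) (g (f x))%:E =
                                 \int[m]_(x in f @^-1` B) (F x)%:E)%E].
Proof.
have dom : image_charge `<< image_measure.
  apply: dominates_pushforward => //; apply/null_content_dominatesP => A mA mA0.
  by apply: null_set_integral => //; apply: measurable_funTS; exact: measurable_int iF.
pose rn := Radon_Nikodym image_charge image_measure.
have rn_fin y : rn y \is a fin_num by exact: Radon_Nikodym_fin_num.
have rn_int : image_measure.-integrable setT rn by exact: Radon_Nikodym_integrable.
have mrn : measurable_fun setT rn by exact: measurable_int rn_int.
have fineE : EFin \o (fine \o rn \o f) = rn \o f.
  by apply/funext => x /=; rewrite fineK.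
have irnf : m.-integrable setT (rn \o f).
  apply/integrableP; split; first exact: measurableT_comp.
  have /integrableP[_] := rn_int; rewrite ge0_integral_pushforward//.
  exact: measurableT_comp.
exists (fine \o rn); split => [||B mB].
- exact: measurableT_comp.
- by rewrite fineE.
under eq_integral do rewrite [(_ (f _))%:E]fineK//.
rewrite -(integral_pushforward mf mrn)//; last first.
  by apply: (integrableS measurableT) => //; rewrite -[X in measurable X]setTI; exact: mf.
exact/esym/(Radon_Nikodym_integral dom mB).
Qed.

End radon_nikodym_image.

Section conditional_expectation.
Context {d} {T : measurableType d} {R : realType}.
Context (G : set (set T)) (F : T -> R).
Hypothesis measurableG : G `<=` measurable.

Lemma cond_exp_exists (m : {finite_measure set T -> \bar R}) : sigma_algebra setT G ->
  m.-integrable setT (EFin \o F) -> exists g, is_cond_exp m G F g.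
Proof.
move=> sG iF; pose TG := g_sigma_algebraType G.
have TGE : measurable = G :> set (set TG) by exact: measurable_g_measurableTypeE.
have mid : measurable_fun setT (id : T -> TG).
  by move=> _ A; rewrite setTI preimage_id TGE; exact: measurableG.
have [g [mg ig gF]] := Radon_Nikodym_image mid iF.
exists g; split => // [B mB|A GA]; last by apply: gF; rewrite TGE.
by rewrite -TGE -[X in measurable X]setTI; exact: mg.
Qed.

Lemma cond_exp_ae_eq (m : {measure set T -> \bar R}) g g' :
  is_cond_exp m G F g -> measurable_wrt G g' -> {ae m, forall x, g' x = g x} ->
  is_cond_exp m G F g'.
Proof.
move=> [Gg ig gF] Gg' gg'.
have mg : measurable_fun setT g := measurable_fun_integrable ig.
have mg' : measurable_fun setT g'.
  by move=> _ B mB; rewrite setTI; exact/measurableG/Gg'.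
have eq_int A (u : R -> R) : measurable A -> measurable_fun setT u ->
    (\int[m]_(x in A) (u (g' x))%:E = \int[m]_(x in A) (u (g x))%:E)%E.
  move=> mA m_u; apply: ae_eq_integral => //.
  - by apply/measurable_EFinP/measurable_funTS; exact: measurableT_comp.
  - by apply/measurable_EFinP/measurable_funTS; exact: measurableT_comp.
  - by apply: filterS gg' => x ->.
split=> // [|A GA]; last by rewrite -gF//; exact/(eq_int A id)/measurable_id/measurableG.
have /integrableP[_ g_fin] := ig; apply/integrableP; split.
  exact/measurable_EFinP.
by rewrite (eq_int setT Num.norm).
Qed.

End conditional_expectation.

(** * Limits of measurable functions *)

Section measurability_of_limits.
Context {d} {T : measurableType d} {R : realType}.
Implicit Types (f g : T -> R) (u : nat -> T -> R).

Lemma measurable_lt_set f g : measurable_fun setT f -> measurable_fun setT g ->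
  measurable [set x | f x < g x].
Proof.
move=> mf mg; rewrite -[X in measurable X]setTI.
exact: (measurable_fun_ltr mf mg measurableT (Y := [set true])).
Qed.

Lemma cvgn_cauchyP (v : nat -> R) : cvgn v <->
  forall k, exists N, forall n, `|v N - v (N + n)%N| < k.+1%:R^-1.
Proof.
split=> [/cvg_ex[l vl] k|cauchy_v].
  have half_gt0 : 0 < k.+1%:R^-1 / 2 :> R by rewrite divr_gt0// invr_gt0.
  move/cvgrPdist_lt: vl => /(_ _ half_gt0)[N _ vlN].
  exists N => n; rewrite [ltRHS]splitr.
  apply: le_lt_trans (ler_distD l _ _) (ltrD _ _); last by apply: vlN; exact: leq_addr.
  by rewrite distrC; exact: vlN (leqnn N).
apply/cauchy_cvgP/cauchy_exP => e e_gt0.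
have [k] := ltr_add_invr e_gt0; rewrite add0r => ke.
have [N vN] := cauchy_v k; exists (v N).
by exists N => // n /= /subnKC <-; exact: lt_trans (vN _) ke.
Qed.

Lemma measurable_cvgn_set u : (forall n, measurable_fun setT (u n)) ->
  measurable [set x | cvgn (u ^~ x)].
Proof.
move=> m_u.
rewrite (_ : mkset _ = \bigcap_k \bigcup_N \bigcap_n
    [set x | `|u N x - u (N + n)%N x| < k.+1%:R^-1]); last first.
  apply/seteqP; split => x.
    by move/cvgn_cauchyP => ux k _; have [N uN] := ux k; exists N => // n _; exact: uN.
  move=> ux; apply/cvgn_cauchyP => k; have [N _ uN] := ux k I.
  by exists N => n; exact: uN n I.
apply: bigcapT_measurable => k; apply: bigcupT_measurable => N.
apply: bigcapT_measurable => n; apply: measurable_lt_set => //.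
by apply: measurableT_comp => //; exact: measurable_funB.
Qed.

Lemma measurable_fun_limn u : (forall n, measurable_fun setT (u n)) ->
  measurable_fun setT (fun x => limn (u ^~ x)).
Proof.
move=> m_u; have mC := measurable_cvgn_set m_u.
rewrite -(setUv [set x | cvgn (u ^~ x)]).
apply/(measurable_funU _ mC (measurableC mC)); split.
  by apply: (measurable_fun_cvg (h := u)) => [n|//]; exact: measurable_funTS.
apply: (eq_measurable_fun (cst point)); last exact: measurable_cst.
by move=> x /[!inE] /dvgP ->.
Qed.

End measurability_of_limits.

(** * The pointwise ergodic theorem *)

Definition measure_preserving {d} {T : measurableType d} {R : realType}
    (m : {measure set T -> \bar R}) (S : T -> T) :=
  measurable_fun setT S /\ forall A, measurable A -> m (S @^-1` A) = m A.

Section measure_preserving_theory.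
Context {d} {T : measurableType d} {R : realType}.
Context (m : {measure set T -> \bar R}) (S : T -> T).
Hypothesis mpS : measure_preserving m S.

Lemma ge0_integral_comp_invariant (f : T -> \bar R) B : measurable_fun setT f ->
  (forall x, (0 <= f x)%E) -> invariant_sets S B ->
  (\int[m]_(x in B) f (S x) = \int[m]_(x in B) f x)%E.
Proof.
have [mS pS] := mpS; move=> mf f0 [mB SB]; rewrite -{1}SB.
rewrite -(ge0_integral_pushforward mS m mB)//; last exact: measurable_funTS.
by apply: eq_measure_integral => A mA _; rewrite /= /pushforward; exact: pS.
Qed.

Lemma integrable_comp_measure_preserving (h : T -> R) :
  m.-integrable setT (EFin \o h) -> m.-integrable setT (EFin \o (h \o S)).
Proof.
move=> /integrableP[mh ih]; apply/integrableP; split.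
  exact: measurableT_comp mh mpS.1.
rewrite (ge0_integral_comp_invariant (f := abse \o (EFin \o h)))// => [|x].
  exact: measurableT_comp.
exact: abse_ge0.
Qed.

End measure_preserving_theory.

Section invariant_sets.
Context {d} {T : measurableType d} (S : T -> T).

Lemma measurable_invariant_sets : invariant_sets S `<=` measurable.
Proof. by move=> A []. Qed.

Lemma sigma_algebra_invariant_sets : sigma_algebra setT (invariant_sets S).
Proof.
split=> [|A [mA SA]|A SA]; split.
- exact: measurable0.
- exact: preimage_set0.
- by rewrite setTD; exact: measurableC.
- by rewrite setTD -preimage_setC SA.
- by apply: bigcupT_measurable => n; exact: (SA n).1.
- by rewrite preimage_bigcup; apply: eq_bigcupr => n _; exact: (SA n).2.
Qed.

Lemma measurable_wrt_invariant_setsP {R : realType} (g : T -> R) :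
  measurable_wrt (invariant_sets S) g <->
  measurable_fun setT g /\ forall x, g (S x) = g x.
Proof.
split=> [gS|[mg gS] B mB]; last first.
  split; first by rewrite -[X in measurable X]setTI; exact: mg.
  by apply/seteqP; split => x /=; rewrite gS.
split=> [_ B mB|x]; first by rewrite setTI; exact: (gS B mB).1.
have [_ gxS] := gS [set g x] (measurable_set1 _).
by have : (g @^-1` [set g x]) x by []; rewrite -{1}gxS.
Qed.

End invariant_sets.

Lemma cvg_affine_coefP {R : realType} {I : Type} {F : set_system I}
    {FF : Filter F} (a c b : I -> R) (l : R) :
  c i @[i --> F] --> (1 : R) -> b i @[i --> F] --> (0 : R) ->
  b i + c i * a i @[i --> F] --> l <-> a i @[i --> F] --> l.
Proof.
move=> c1 b0; split=> [abl|al]; last first.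
  by rewrite -[l]add0r -[l in X in _ --> X]mul1r; apply: cvgD => //; exact: cvgM.
have : (c i)^-1 * (b i + c i * a i - b i) @[i --> F] --> 1^-1 * (l - 0).
  by apply: cvgM; [apply: cvgV => //; exact: oner_neq0|exact: cvgB].
rewrite invr1 mul1r subr0; apply: cvg_trans; apply: near_eq_cvg; near=> i.
have ci_neq0 : c i != 0.
  by near: i; move/cvgr_neq0 : c1; apply; exact: oner_neq0.
by rewrite addrAC subrr add0r mulKf.
Unshelve. all: by end_near. Qed.

Section birkhoff_sums.
Context {T : Type} {R : realType} (S : T -> T).
Implicit Types (h g : T -> R) (n : nat) (x : T).

Definition birkhoff_sum h n x : R := \sum_(i < n) h (iter i S x).

Definition birkhoff_avg h n x : R := n%:R^-1 * birkhoff_sum h n x.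

(* By [birkhoff_sumS], the maximum of the Birkhoff sums of lengths [0] to [n]. *)
Fixpoint birkhoff_max h n x : R :=
  if n is n'.+1 then Num.max 0 (h x + birkhoff_max h n' (S x)) else 0.

Definition birkhoff_unbounded h : set T :=
  [set x | forall c : R, exists n, c < birkhoff_sum h n x].

Lemma birkhoff_sum0 h x : birkhoff_sum h 0 x = 0.
Proof. by rewrite /birkhoff_sum big_ord0. Qed.

Lemma birkhoff_sumS h n x :
  birkhoff_sum h n.+1 x = h x + birkhoff_sum h n (S x).
Proof.
rewrite /birkhoff_sum big_ord_recl; congr (_ + _).
by apply: eq_bigr => i _; rewrite -iterSr.
Qed.

Lemma birkhoff_sumN h n x : birkhoff_sum (\- h) n x = - birkhoff_sum h n x.
Proof. by rewrite /birkhoff_sum sumrN. Qed.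

Lemma birkhoff_sumB_invariant h g n x : (forall y, g (S y) = g y) ->
  birkhoff_sum (h \- g) n x = birkhoff_sum h n x - n%:R * g x.
Proof.
move=> gS; elim: n x => [|n IHn] x; first by rewrite !birkhoff_sum0 mul0r subr0.
by rewrite !birkhoff_sumS IHn gS -natr1 /=; ring.
Qed.

Lemma birkhoff_max_ge0 h n x : 0 <= birkhoff_max h n x.
Proof. by case: n => //= n; rewrite le_max lexx. Qed.

Lemma birkhoff_max_leS h n x : birkhoff_max h n x <= birkhoff_max h n.+1 x.
Proof.
elim: n x => [|n IHn] x; first exact: birkhoff_max_ge0.
by rewrite [leLHS]/= [leRHS]/= ge_max le_max lexx/= le_max lerD2l IHn orbT.
Qed.

Lemma birkhoff_max_nd h x : {homo birkhoff_max h ^~ x : n m / (n <= m)%N >-> n <= m}.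
Proof. by apply: homo_leq => // [|n]; [exact: le_trans|exact: birkhoff_max_leS]. Qed.

Lemma birkhoff_sum_le_max h n x : birkhoff_sum h n x <= birkhoff_max h n x.
Proof.
elim: n x => [|n IHn] x; first by rewrite birkhoff_sum0.
by rewrite birkhoff_sumS /= le_max lerD2l IHn orbT.
Qed.

Lemma birkhoff_max_le_restrict h n x :
  birkhoff_max h n x <=
  (h \_ [set y | 0 < birkhoff_max h n y]) x + birkhoff_max h n (S x).
Proof.
rewrite patchE; case: ifPn => [|/negP]; rewrite inE/=.
  case: n => [|n]; first by rewrite ltxx.
  rewrite [ltRHS]/= lt_max ltxx /= => /ltW/max_r ->.
  by rewrite lerD2l; exact: birkhoff_max_leS.
by move=> /negP; rewrite -leNgt add0r => /le_trans; apply; exact: birkhoff_max_ge0.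
Qed.

Lemma birkhoff_unbounded_invariant h :
  S @^-1` birkhoff_unbounded h = birkhoff_unbounded h.
Proof.
apply/seteqP; split => x ubx c.
  have [n] := ubx (c - h x); exists n.+1.
  by rewrite birkhoff_sumS; lra.
have [[|n]] := ubx (Num.max 0 (c + h x)); first by rewrite birkhoff_sum0 gt_max ltxx.
by rewrite birkhoff_sumS gt_max => /andP[_ cn]; exists n; lra.
Qed.

Lemma near_birkhoff_avg_le h b r x : ~ birkhoff_unbounded (h \- cst b) x -> b < r ->
  \forall n \near \oo, birkhoff_avg h n x <= r.
Proof.
move=> /existsNP[c /forallNP sum_le_c] br; near=> n.
have n_gt0 : 0 < n%:R :> R by rewrite ltr0n; near: n; exact: nbhs_infty_gt.
have : c / (r - b) <= n%:R by near: n; exact: nbhs_infty_ger.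
rewrite ler_pdivrMr ?subr_gt0// /birkhoff_avg ler_pdivrMl//.
have /negP := sum_le_c n; rewrite -leNgt birkhoff_sumB_invariant//=.
by lra.
Unshelve. all: by end_near. Qed.

Lemma cvg_birkhoff_avg0 h x :
  (forall k, ~ birkhoff_unbounded (h \- cst k.+1%:R^-1) x) ->
  (forall k, ~ birkhoff_unbounded (\- h \- cst k.+1%:R^-1) x) ->
  birkhoff_avg h n x @[n --> \oo] --> 0.
Proof.
move=> h_le Nh_le; apply/cvgrPdist_le => e e_gt0.
have [k] := ltr_add_invr e_gt0; rewrite add0r => ke.
near=> n; rewrite sub0r normrN ler_norml; apply/andP; split.
  rewrite lerNl -mulrN -birkhoff_sumN.
  by near: n; exact: near_birkhoff_avg_le (Nh_le k) ke.
by near: n; exact: near_birkhoff_avg_le (h_le k) ke.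
Unshelve. all: by end_near. Qed.

Lemma cvg_birkhoff_avgB_invariant h g x : (forall y, g (S y) = g y) ->
  birkhoff_avg (h \- g) n x @[n --> \oo] --> 0 ->
  birkhoff_avg h n x @[n --> \oo] --> g x.
Proof.
move=> gS avg0; rewrite -[g x]add0r.
have : birkhoff_avg (h \- g) n x + g x @[n --> \oo] --> 0 + g x.
  by apply: cvgD => //; exact: cvg_cst.
apply: cvg_trans; apply: near_eq_cvg; near=> n.
have n_neq0 : n%:R != 0 :> R by rewrite pnatr_eq0 -lt0n; near: n; exact: nbhs_infty_gt.
by rewrite /birkhoff_avg birkhoff_sumB_invariant// mulrBr mulKf// subrK.
Unshelve. all: by end_near. Qed.

Lemma cvg_birkhoff_avg_comp h x (l : R) :
  birkhoff_avg h n (S x) @[n --> \oo] --> l <-> birkhoff_avg h n x @[n --> \oo] --> l.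
Proof.
have avgS n : birkhoff_avg h n.+1 x =
    n.+1%:R^-1 * h x + (1 - n.+1%:R^-1) * birkhoff_avg h n (S x).
  rewrite /birkhoff_avg birkhoff_sumS; case: n => [|n].
    by rewrite birkhoff_sum0 invr1 subrr mul0r !addr0.
  by rewrite -!natr1; field; rewrite !natr1 !pnatr_eq0.
have inv_to0 : n.+1%:R^-1 @[n --> \oo] --> (0 : R) by exact: cvg_harmonic.
rewrite -(cvg_shiftS (birkhoff_avg h ^~ x)) (funext avgS); apply: iff_sym.
apply: cvg_affine_coefP.
- rewrite -[X in _ --> X]subr0; apply: cvgB => //; exact: cvg_cst.
- by rewrite -(mul0r (h x)); apply: cvgM => //; exact: cvg_cst.
Qed.

Definition birkhoff_lim h x : R := limn (birkhoff_avg h ^~ x).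

(* No convergence is needed: [limn] picks a point of the set of limits, which is the
   same for [x] and [S x]. *)
Lemma birkhoff_lim_comp h x : birkhoff_lim h (S x) = birkhoff_lim h x.
Proof.
rewrite /birkhoff_lim /lim_in; congr get; apply/funext => l.
by apply/propext; exact: cvg_birkhoff_avg_comp.
Qed.

End birkhoff_sums.

Section birkhoff_measurability.
Context {d} {T : measurableType d} {R : realType} (S : T -> T) (h : T -> R).
Hypotheses (mS : measurable_fun setT S) (mh : measurable_fun setT h).

Lemma measurable_birkhoff_sum n : measurable_fun setT (birkhoff_sum S h n).
Proof.
apply: measurable_sum => i; apply: measurableT_comp mh _.
by elim: (i : nat) => [|j IHj]; [exact: measurable_id|exact: measurableT_comp mS IHj].
Qed.

Lemma measurable_birkhoff_avg n : measurable_fun setT (birkhoff_avg S h n).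
Proof. by apply: measurable_funM => //; exact: measurable_birkhoff_sum. Qed.

Lemma measurable_birkhoff_max n : measurable_fun setT (birkhoff_max S h n).
Proof.
elim: n => [|n IHn]; first exact: measurable_cst.
apply: (measurable_maxr (f := cst 0)); first exact: measurable_cst.
by apply: measurable_funD => //; exact: measurableT_comp IHn mS.
Qed.

Lemma invariant_birkhoff_unbounded : invariant_sets S (birkhoff_unbounded S h).
Proof.
split; last exact: birkhoff_unbounded_invariant.
have -> : birkhoff_unbounded S h =
    \bigcap_k \bigcup_n [set x | k%:R < birkhoff_sum S h n x].
  apply/seteqP; split => x ubx => [k _|c]; first by have [n] := ubx k%:R; exists n.
  have [n _ /= kn] := ubx (Num.truncn `|c|).+1 I; exists n; apply: lt_trans kn.
  exact: le_lt_trans (ler_norm c) (truncnS_gt _).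
apply: bigcapT_measurable => k; apply: bigcupT_measurable => n.
by apply: measurable_lt_set => //; exact: measurable_birkhoff_sum.
Qed.

End birkhoff_measurability.

Section maximal_ergodic.
Context {d} {T : measurableType d} {R : realType}.
Context (m : {measure set T -> \bar R}) (S : T -> T) (h : T -> R).
Hypotheses (mpS : measure_preserving m S) (ih : m.-integrable setT (EFin \o h)).

Let mS : measurable_fun setT S. Proof. exact: mpS.1. Qed.

Let mh : measurable_fun setT h.
Proof. exact: measurable_fun_integrable ih. Qed.

Lemma integrable_birkhoff_max n : m.-integrable setT (EFin \o birkhoff_max S h n).
Proof.
elim: n => [|n IHn]; first exact: integrable0.
have iS := integrable_comp_measure_preserving mpS IHn.
apply: (le_integrable _ _ _ (integrableD measurableT ih iS)) => //.
  by apply/measurable_EFinP; exact: (measurable_birkhoff_max mS mh n.+1).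
move=> x _ /=; rewrite lee_fin (ger0_norm (birkhoff_max_ge0 S h n.+1 x)).
by rewrite ge_max normr_ge0 ler_norm.
Qed.

(* Integrate [birkhoff_max_le_restrict]: over an invariant set the two maxima
   have the same integral. *)
Lemma maximal_ergodic_max n B : invariant_sets S B ->
  (0 <= \int[m]_(x in B `&` [set x | (0 < birkhoff_max S h n x)%R]) (h x)%:E)%E.
Proof.
move=> invB; have mB := invB.1.
set f := birkhoff_max S h n; set E := [set x | _].
have mE : measurable E by apply: measurable_lt_set => //; exact: measurable_birkhoff_max.
have i_f : m.-integrable B (EFin \o f).
  by apply: integrableS (integrable_birkhoff_max n).
have ifS : m.-integrable B (EFin \o (f \o S)).
  apply: integrableS (integrable_comp_measure_preserving mpS _) => //.
  exact: integrable_birkhoff_max.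
have ihE : m.-integrable B ((EFin \o h) \_ E).
  apply: (integrableS measurableT) => //.
  by apply/(integrable_mkcond _ mE); exact: integrableS ih.
rewrite integral_mkcondr.
have : (\int[m]_(x in B) (f x)%:E <=
    \int[m]_(x in B) (((EFin \o h) \_ E) x + (f (S x))%:E))%E.
  apply: le_integral => //; first exact: integrableD.
  by move=> x _; rewrite restrict_EFin -EFinD lee_fin birkhoff_max_le_restrict.
rewrite integralD// (ge0_integral_comp_invariant mpS (f := EFin \o f))//; last 2 first.
- by apply/measurable_EFinP; exact: measurable_birkhoff_max.
- by move=> x; rewrite lee_fin birkhoff_max_ge0.
by rewrite -leeBlDr ?subee//; exact: integrable_fin_num.
Qed.

Lemma maximal_ergodic B : invariant_sets S B ->
  (forall x, B x -> exists n, 0 < birkhoff_sum S h n x) ->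
  (0 <= \int[m]_(x in B) (h x)%:E)%E.
Proof.
move=> invB Bpos; have mB := invB.1.
pose E n := [set x | 0 < birkhoff_max S h n x].
have mE n : measurable (E n).
  by apply: measurable_lt_set => //; exact: measurable_birkhoff_max.
have mhE n : measurable_fun B ((EFin \o h) \_ (E n)).
  apply: measurable_funTS; apply/(measurable_restrictT _ (mE n)).
  by apply: measurable_funTS; exact/measurable_EFinP.
have [| | | |_ _ cv] := @dominated_convergence _ _ _ m B mB
  (fun n => (EFin \o h) \_ (E n)) (EFin \o h) (abse \o (EFin \o h)) mhE.
- by apply: measurable_funTS; exact/measurable_EFinP.
- apply: aeW => x Bx; have [N sum_gt0] := Bpos x Bx.
  apply: cvg_near_cst; exists N => // n /= Nn; rewrite patchE mem_set//.
  apply: lt_le_trans sum_gt0 (le_trans (birkhoff_sum_le_max _ _ _ _) _).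
  exact: birkhoff_max_nd.
- by apply: integrable_abse; exact: integrableS ih.
- by apply: aeW => x n _; rewrite patchE; case: ifP => //= _; rewrite normr0 lee_fin.
apply: (cvge_ge _ cv); apply: nearW => n /=.
by rewrite -integral_mkcondr; exact: maximal_ergodic_max.
Qed.

End maximal_ergodic.

Section pointwise_ergodic.
Context {d} {T : measurableType d} {R : realType}.
Context (m : {finite_measure set T -> \bar R}) (S : T -> T).
Hypothesis mpS : measure_preserving m S.

Lemma ae_birkhoff_bounded (h : T -> R) (e : R) :
  m.-integrable setT (EFin \o h) -> 0 < e ->
  (forall B, invariant_sets S B -> \int[m]_(x in B) (h x)%:E = 0)%E ->
  {ae m, forall x, ~ birkhoff_unbounded S (h \- cst e) x}.
Proof.
move=> ih e_gt0 h0; set B := birkhoff_unbounded _ _.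
have ie : m.-integrable setT (EFin \o cst e) by exact: finite_measure_integrable_cst.
have ihe : m.-integrable setT (EFin \o (h \- cst e)).
  exact: (integrableB measurableT ih ie).
have invB : invariant_sets S B.
  exact: invariant_birkhoff_unbounded mpS.1 (measurable_fun_integrable ihe).
have mB := invB.1; exists B; split => // [|x /contrapT//].
have : (0 <= \int[m]_(x in B) ((h \- cst e) x)%:E)%E.
  by apply: maximal_ergodic mpS ihe _ invB _ => x /(_ 0).
under eq_integral do rewrite EFinB.
rewrite integralB_EFin//; [|exact: integrableS ih|exact: integrableS ie].
rewrite h0// sub0e (integral_cst m mB e%:E) oppe_ge0 pmule_rle0 ?lte_fin// => mB_le0.
by apply/eqP; rewrite eq_le mB_le0 measure_ge0.
Qed.

Lemma ae_cvg_birkhoff_avg0 (h : T -> R) : m.-integrable setT (EFin \o h) ->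
  (forall B, invariant_sets S B -> \int[m]_(x in B) (h x)%:E = 0)%E ->
  {ae m, forall x, birkhoff_avg S h n x @[n --> \oo] --> 0}.
Proof.
move=> ih h0.
have Nh0 B : invariant_sets S B -> (\int[m]_(x in B) ((\- h) x)%:E = 0)%E.
  move=> invB; have mB := invB.1; under eq_integral do rewrite EFinN.
  rewrite integralN ?h0 ?oppe0//; apply: integrable_add_def => //.
  exact: integrableS ih.
have h_bounded : {ae m, forall x k, ~ birkhoff_unbounded S (h \- cst k.+1%:R^-1) x}.
  by apply: ae_foralln => k; exact: ae_birkhoff_bounded.
have Nh_bounded :
    {ae m, forall x k, ~ birkhoff_unbounded S (\- h \- cst k.+1%:R^-1) x}.
  by apply: ae_foralln => k; apply: ae_birkhoff_bounded => //; exact: (integrableN ih).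
by apply: filterS2 h_bounded Nh_bounded => x; exact: cvg_birkhoff_avg0.
Qed.

Context (F : T -> R) (iF : m.-integrable setT (EFin \o F)).

Theorem pointwise_ergodic (g : T -> R) : is_cond_exp m (invariant_sets S) F g ->
  {ae m, forall x, birkhoff_avg S F n x @[n --> \oo] --> g x}.
Proof.
move=> [/measurable_wrt_invariant_setsP[_ gS] ig gF].
have := @ae_cvg_birkhoff_avg0 (F \- g) (integrableB measurableT iF ig).
have Fg0 B : invariant_sets S B -> (\int[m]_(x in B) ((F \- g) x)%:E = 0)%E.
  move=> invB; have mB := invB.1.
  have iFB : m.-integrable B (EFin \o F) by exact: integrableS iF.
  under eq_integral do rewrite EFinB.
  rewrite integralB_EFin ?gF ?subee//; last exact: integrableS ig.
  exact: integrable_fin_num.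
by move=> /(_ Fg0); apply: filterS => x; exact: cvg_birkhoff_avgB_invariant.
Qed.

Corollary ae_cvgn_birkhoff_avg : {ae m, forall x, cvgn (birkhoff_avg S F ^~ x)}.
Proof.
have [g gF] := cond_exp_exists (@measurable_invariant_sets _ _ S)
  (sigma_algebra_invariant_sets S) iF.
by apply: filterS (pointwise_ergodic gF) => x xg; apply/cvg_ex; exists (g x).
Qed.

Corollary birkhoff_lim_cond_exp :
  is_cond_exp m (invariant_sets S) F (birkhoff_lim S F).
Proof.
have [g gF] := cond_exp_exists (@measurable_invariant_sets _ _ S)
  (sigma_algebra_invariant_sets S) iF.
apply: (cond_exp_ae_eq (@measurable_invariant_sets _ _ S) gF).
  apply/measurable_wrt_invariant_setsP; split; last exact: birkhoff_lim_comp.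
  apply: measurable_fun_limn => n.
  exact: measurable_birkhoff_avg mpS.1 (measurable_fun_integrable iF) n.
by apply: filterS (pointwise_ergodic gF) => x; exact: cvg_lim.
Qed.

End pointwise_ergodic.

(** * Skew products *)

Definition skew_product {M T K : Type} (tau : M -> M) (theta : K -> T -> T)
  (kappa : M -> K) (x : M * T) : M * T := (tau x.1, theta (kappa x.1) x.2).

Section skew_product_iter.
Context {M T : Type} {V : nmodType} (K : set V).
Context (tau : M -> M) (theta : V -> T -> T) (kappa : M -> V).
Hypotheses (K0 : K 0) (KD : forall k l, K k -> K l -> K (k + l)).
Hypotheses (theta0 : theta 0 = id)
  (thetaD : forall k l, K k -> K l -> theta k \o theta l = theta (k + l)).

Lemma iter_skew_product n t w : (forall s, K (kappa s)) ->
  iter n (skew_product tau theta kappa) (t, w) =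
  (iter n tau t, theta (\sum_(i < n) kappa (iter i tau t)) w).
Proof.
move=> Kkappa; elim: n => [|n IHn]; first by rewrite big_ord0 theta0.
have Ksum : K (\sum_(i < n) kappa (iter i tau t)) by exact: big_ind.
by rewrite iterS IHn big_ord_recr /= addrC -thetaD.
Qed.

End skew_product_iter.

Section measure_preserving_skew_product.
Context {d1 d2} {T1 : measurableType d1} {T2 : measurableType d2} {R : realType}.
Context (mu : {measure set T1 -> \bar R}) (P : {sigma_finite_measure set T2 -> \bar R}).
Context {K : countType} (tau : T1 -> T1) (theta : K -> T2 -> T2) (kappa : T1 -> K).
Hypothesis mkappa : forall k, measurable (kappa @^-1` [set k]).

Lemma measurable_skew_product : measurable_fun setT tau ->
  (forall t, measurable_fun setT (theta (kappa t))) ->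
  measurable_fun setT (skew_product tau theta kappa).
Proof.
move=> mtau mtheta; apply: measurable_fun_pair; first exact: measurableT_comp.
move=> _ A mA; rewrite setTI.
rewrite (_ : _ @^-1` _ =
    \bigcup_(k in range kappa) ((kappa @^-1` [set k]) `*` (theta k @^-1` A))).
  rewrite bigcup_mkcond; apply: countable_bigcupT_measurable => // k.
  case: ifPn => [/[!inE] -[t _ <-]|_]; last exact: measurable0.
  by apply: measurableX => //; rewrite -[X in measurable X]setTI; exact: mtheta.
by apply/seteqP; split => [[t w] ?|[t w] [_ _ [<-]]]; first by exists (kappa t).
Qed.

Lemma measure_preserving_skew_product : measure_preserving mu tau ->
  (forall t, measure_preserving P (theta (kappa t))) ->
  measure_preserving (mu \x P)%E (skew_product tau theta kappa).
Proof.
move=> ptau ptheta; split=> [|A mA].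
  by apply: measurable_skew_product => [|t]; [exact: ptau.1|exact: (ptheta t).1].
rewrite /= /product_measure1.
have -> : P \o xsection (skew_product tau theta kappa @^-1` A) =
    (P \o xsection A) \o tau.
  apply/funext => t /=.
  rewrite -((ptheta t).2 (xsection A (tau t))); last exact: measurable_xsection.
  by congr (P _); apply/seteqP; split => w /=; rewrite /xsection /= !inE.
rewrite (ge0_integral_comp_invariant ptau (f := P \o xsection A))//.
exact: measurable_fun_xsection.
Qed.

End measure_preserving_skew_product.

(** * From almost everywhere to uniform convergence *)

Lemma ae_product_ysection {d1 d2} {T1 : measurableType d1} {T2 : measurableType d2}
    {R : realType} (m1 : {sigma_finite_measure set T1 -> \bar R})
    (m2 : {sigma_finite_measure set T2 -> \bar R}) (Q : T1 * T2 -> Prop) :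
  {ae (m1 \x m2)%E, forall z, Q z} -> {ae m2, forall y, {ae m1, forall x, Q (x, y)}}.
Proof.
move=> [N [mN N0 QN]].
have : {ae m2, forall y, m1 (ysection N y) = 0%E}.
  have mN1 := measurable_fun_ysection m1 mN.
  have [+ _] := ae_eq_integral_abs m2 measurableT mN1.
  rewrite (eq_integral (m1 \o ysection N)); last by move=> y _; rewrite gee0_abs.
  have NE : (m1 \x^ m2)%E N = 0%E.
    by rewrite -N0; apply/esym/product_measure_unique => // A B; exact: product_measure2E.
  by move=> /(_ NE); apply: filterS => y; exact.
apply: filterS => y Ny0; exists (ysection N y); split => //.
- exact: measurable_ysection.
- by move=> x nQx; apply/ysectionP/QN.
Qed.

Lemma ae_dense {R : realType} {M : ptopologicalType}
    (mu : {measure set (borel_of M) -> \bar R}) (Q : M -> Prop) :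
  (forall U : set M, open U -> U !=set0 -> (0 < mu U)%E) ->
  {ae mu, forall t, Q t} -> dense [set t | Q t].
Proof.
move=> mu_gt0 [N [mN N0 QN]] U [t Ut] oU; apply: contrapT => /nonemptyPn UQ0.
have : (0 < mu U)%E by apply: mu_gt0 => //; exists t.
rewrite (subset_measure0 _ mN _ N0) ?ltxx//; first exact: sub_sigma_algebra.
by move=> s Us; apply: QN => Qs; rewrite -[False]/(set0 s) -UQ0.
Qed.

Lemma continuous_measurable_borel {M N : ptopologicalType} (f : M -> N) :
  continuous f -> measurable_fun setT (f : borel_of M -> borel_of N).
Proof.
move=> cf; apply: (@measurability _ _ (borel_of M) (borel_of N) setT f (@open N)) => //.
move=> _ [A oA <-]; rewrite setTI; apply: sub_sigma_algebra.
by apply: open_comp => // x _; exact: cf.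
Qed.

Section equicontinuous_families.
Context {I : Type} {F : set_system I} {FF : ProperFilter F} (W : set I).
Hypothesis FW : F W.

Lemma equicontinuous_dense_cvg {X : topologicalType} {Y : completeType}
    (a : I -> X -> Y) : equicontinuous W a ->
  dense [set x | cvg (a ^~ x @ F)] -> forall x, cvg (a ^~ x @ F).
Proof.
move=> a_equi a_dense x; apply/cauchy_cvgP => E entE.
pose E1 := split_ent E; pose E2 := split_ent E1.
have entE1 : entourage E1 by exact: entourage_split_ent.
have entE2 : entourage E2 by exact: entourage_split_ent.
pose close := [set s | forall i, W i -> (E1 `&` E2^-1%relation) (a i x, a i s)].
have [s [/interior_subset close_s]] : close° `&` [set s | cvg (a ^~ s @ F)] !=set0.
  apply: a_dense; last exact: open_interior.
  by exists x; apply: a_equi; apply: filterI => //; exact: entourage_inv.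
move=> /cvg_cauchy/(_ E2 entE2)[[A B] [/= FA FB] ABE2].
have FWA : F (W `&` (a ^~ s @^-1` A)) by exact: filterI.
have FWB : F (W `&` (a ^~ s @^-1` B)) by exact: filterI.
exists (a ^~ x @` (W `&` (a ^~ s @^-1` A)), a ^~ x @` (W `&` (a ^~ s @^-1` B))).
  by split; [apply: (@filterS _ F _ _ _ _ FWA)|apply: (@filterS _ F _ _ _ _ FWB)]
    => i Wi; exists i.
move=> [_ _] [/= [i [Wi As] <-] [j [Wj Bs] <-]].
apply: (entourage_split (a i s)) => //; first by case: (close_s i Wi).
apply: (entourage_split (a j s)) => //; first exact: (ABE2 (_, _)).
by case: (close_s j Wj).
Qed.

Lemma equicontinuous_compact_cvg {X : topologicalType} {Y : puniformType}
    (a : I -> X -> Y) (g : X -> Y) : equicontinuous W a ->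
  compact [set: X] -> (forall x, a i x @[i --> F] --> g x) ->
  {uniform, a @ F --> g}.
Proof.
move=> a_equi cX ag.
suff : {family compact, a @ F --> g} by move=> /fam_cvgP/(_ _ cX).
apply/pointwise_compact_cvg; last exact/pointwise_cvgP.
apply/near_powerset_filter_fromP; first exact: equicontinuous_subset_id.
exists (a @` W); first by apply: (@filterS _ F _ _ _ _ FW) => i Wi; exists i.
by apply: equicontinuous_subset a_equi; rewrite image_id.
Qed.

End equicontinuous_families.

Lemma uniform_cvg_ereal_sup {I : Type} {F : set_system I} {FF : Filter F}
    {X : pointedType} {R : realType} (a : I -> X -> R) (g : X -> R) :
  {uniform, a @ F --> g} ->
  ereal_sup [set (`|a i x - g x|)%:E | x in [set: X]] @[i --> F] --> 0%E.
Proof.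
move=> ag.
have sup_le e : 0 < e -> \forall i \near F,
    (0 <= ereal_sup [set (`|a i x - g x|)%:E | x in [set: X]] <= e%:E)%E.
  move=> e_gt0.
  have : \forall i \near F, forall x, ball (g x) e (a i x).
    apply: (ag [set h | forall x, ball (g x) e (h x)]); apply/uniform_nbhs.
    exists [set uv | ball uv.1 e uv.2].
    by split=> [|h gh x]; [rewrite -entourage_ballE; exists e|exact: gh].
  apply: filterS => i gai; apply/andP; split.
    apply: (@le_trans _ _ `|a i point - g point|%:E); first by rewrite lee_fin.
    by apply: ereal_sup_ubound; exists point.
  by apply: ge_ereal_sup => _ [x _ <-]; rewrite lee_fin distrC; exact/ltW/gai.
apply/fine_cvgP; split.
  apply: filterS (sup_le 1 ltr01) => i /andP[sup_ge0 sup_le1].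
  by rewrite ge0_fin_numE// (le_lt_trans sup_le1)// ltry.
apply/cvgrPdist_le => e e_gt0; apply: filterS (sup_le e e_gt0) => i /=.
rewrite sub0r normrN => /andP[sup_ge0 sup_lee]; rewrite ger0_norm ?fine_ge0//.
by rewrite -lee_fin fineK// ge0_fin_numE// (le_lt_trans sup_lee)// ltry.
Qed.

Lemma ball_equicontinuous {I : Type} {R : realType} {X : pseudoMetricType R}
    (W : set I) (a : I -> X -> R) :
  (forall x (e : R), 0 < e -> exists2 del : R, 0 < del &
     forall i y, W i -> ball x del y -> `|a i x - a i y| < e) ->
  equicontinuous W a.
Proof.
move=> a_ball x E; rewrite -entourage_ballE => -[e /= e_gt0 eE].
have [del del_gt0 dele] := a_ball x e e_gt0.
apply: filterS (nbhsx_ballx x del del_gt0) => y xy i Wi.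
by apply: eE; exact: dele.
Qed.

Lemma equicontinuous_ae_unif_cvg {I : Type} {F : set_system I} {FF : ProperFilter F}
    (W : set I) {R : realType} {M : ptopologicalType} {d} {T : measurableType d}
    (mu : {sigma_finite_measure set (borel_of M) -> \bar R})
    (P : {sigma_finite_measure set T -> \bar R}) (a : I -> M * T -> R) :
  F W -> compact [set: M] ->
  (forall U : set M, open U -> U !=set0 -> (0 < mu U)%E) ->
  (forall w, equicontinuous W (fun i t => a i (t, w))) ->
  {ae (mu \x P)%E, forall z, cvg (a ^~ z @ F)} ->
  {ae P, forall w, ereal_sup
    [set (`|a i (t, w) - lim (a ^~ (t, w) @ F)|)%:E | t in [set: M]] @[i --> F] --> 0%E}.
Proof.
move=> FW cM mu_gt0 a_equi /ae_product_ysection; apply: filterS => w a_cvg_ae.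
apply: (uniform_cvg_ereal_sup (X := M)).
apply: (equicontinuous_compact_cvg FW (a_equi w) cM).
exact: (equicontinuous_dense_cvg FW (a_equi w) (ae_dense mu_gt0 a_cvg_ae)).
Qed.

Lemma Kset0 grp d : @Kset grp d 0.
Proof. by case: grp => //= i; rewrite mxE. Qed.

Lemma KsetD grp d (k l : 'rV_d) : Kset grp k -> Kset grp l -> Kset grp (k + l).
Proof. by case: grp => //= k_ge0 l_ge0 i; rewrite mxE addr_ge0. Qed.

Theorem theorem4p11 (R : realType) (d : nat) (grp : bool)
  (dO : measure_display) (Omega : measurableType dO) (P : probability Omega R)
  (theta : 'rV[int]_d -> Omega -> Omega)
  (M : pseudoPMetricType R)
  (tau : M -> M) (mu : probability (borel_of M) R)
  (kappa : M -> 'rV[int]_d)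
  (F : borel_of M * Omega -> R) :
  (* semigroup (group if grp) of P-preserving transformations *)
  (forall k, Kset grp k -> measurable_fun setT (theta k) /\
     forall A, measurable A -> P (theta k @^-1` A) = P A) ->
  theta 0 = id ->
  (forall k l, Kset grp k -> Kset grp l -> theta k \o theta l = theta (k + l)) ->
  (* M compact separable metric space *)
  hausdorff_space M ->
  compact [set: M] ->
  (exists D : set M, countable D /\ closure D = setT) ->
  (* tau continuous, mu tau-invariant with full support *)
  continuous tau ->
  (forall A : set (borel_of M), measurable A -> mu (tau @^-1` A) = mu A) ->
  (forall U : set M, open U -> U !=set0 -> (0 < mu U)%E) ->
  (* kappa measurable with values in K *)
  (forall t, Kset grp (kappa t)) ->
  (forall k, measurable (kappa @^-1` [set k] : set (borel_of M))) ->
  (* F measurable, integrable, with integrable sections *)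
  measurable_fun setT F ->
  (mu \x P)%E.-integrable setT (EFin \o F) ->
  (forall t : M, P.-integrable setT (fun w => (F (t, w))%:E)) ->
  let kappa_n (n : nat) (t : M) := \sum_(i < n) kappa (iter i tau t) in
  let avg (n : nat) (t : M) (w : Omega) :=
    (n%:R)^-1 * \sum_(i < n) F (iter i tau t, theta (kappa_n i t) w) in
  let S (x : borel_of M * Omega) : borel_of M * Omega :=
    (tau x.1, theta (kappa x.1) x.2) in
  (* equicontinuity for every omega *)
  (forall w (t : M) (e : R), 0 < e -> exists2 del : R, 0 < del &
     forall (n : nat) (s : M), (0 < n)%N -> ball t del s ->
       `|avg n t w - avg n s w| < e) ->
  exists g : borel_of M * Omega -> R,
    is_cond_exp (mu \x P)%E (invariant_sets S) F g /\
    {ae P, forall w,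
      (fun n => ereal_sup [set (`|avg n t w - g (t, w)|)%:E | t in [set: M]])
        @ \oo --> 0%E}.
Proof.
move=> theta_mp theta0 thetaD _ cM _ ctau mu_tau mu_gt0 Kkappa mkappa _ iF _.
move=> kappa_n avg S avg_equi.
pose muP : probability _ R := (mu \x P)%E.
have mpS : measure_preserving muP S.
  apply: (measure_preserving_skew_product mkappa) => [|t]; last exact: theta_mp.
  by split=> //; exact: continuous_measurable_borel.
have avgE : avg = fun n t w => birkhoff_avg S F n (t, w).
  apply/funext => n; apply/funext => t; apply/funext => w; congr (_ * _).
  apply: eq_bigr => i _; congr F; apply/esym.
  exact: (iter_skew_product tau (@Kset0 grp d) (@KsetD grp d) theta0 thetaD i t w).
exists (birkhoff_lim S F); split; first exact: (birkhoff_lim_cond_exp mpS iF).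
have avg_cvg := ae_cvgn_birkhoff_avg mpS iF; rewrite avgE in avg_equi *.
apply: (equicontinuous_ae_unif_cvg _ cM mu_gt0 _ avg_cvg) => [|w].
  exact: (nbhs_infty_gt 0).
apply: ball_equicontinuous => t e /(avg_equi w t)[del del_gt0 avg_del].
by exists del.
Qed.
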